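(* Let $\mathcal{U}$ be an ultrafilter on $\omega$ which is Tukey reducible to a Fubini iterate of p-points. Then for each ultrafilter $\mathcal{V}$ on $\omega$ with $\mathcal{V}\le_T\mathcal{U}$, there is a set $P\subseteq[\omega]^{<\omega}$ such that the filter $\mathcal{U}(P)$ on $P$ generated by the sets $\{s\in P: s\subseteq U\}$, $U\in\mathcal{U}$, satisfies $\mathcal{U}(P)\equiv_T\mathcal{U}$ and $\mathcal{V}\le_{RK}\mathcal{U}(P)$.
   Context: A p-point is a nonprincipal ultrafilter on $\omega$ such that every decreasing sequence of its members has a member almost contained in each. Fubini product: $\lim_{n\to\mathcal{W}}\mathcal{V}_n=\{A\subseteq\omega\times\omega:\{n:\{j:(n,j)\in A\}\in\mathcal{V}_n\}\in\mathcal{W}\}$. With $\mathcal{P}_0$ the p-points, $\mathcal{P}_{\alpha+1}=\{\lim_{n\to\mathcal{W}}\mathcal{V}_n:\mathcal{W}\in\mathcal{P}_0,\mathcal{V}_n\in\mathcal{P}_\alpha\}$ and unions at limits, a Fubini iterate of p-points is a member of $\bigcup_{\alpha<\omega_1}\mathcal{P}_\alpha$. For filters $\mathcal{F},\mathcal{G}$, $\mathcal{G}\le_T\mathcal{F}$ iff there is a map $\mathcal{F}\to\mathcal{G}$ sending cofinal subsets of $(\mathcal{F},\supseteq)$ to cofinal subsets of $(\mathcal{G},\supseteq)$, and $\equiv_T$ means reducibility both ways. $\mathcal{V}\le_{RK}\mathcal{U}(P)$ means there is $h:P\to\omega$ with $\mathcal{V}=\{Y\subseteq\omega: h^{-1}(Y)\in\mathcal{U}(P)\}$.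 *)

(* Defs.v *)
From mathcomp Require Import all_boot finmap.
From mathcomp Require Import boolp classical_sets functions cardinality filter.
From mathcomp Require wochoice.

Set Implicit Arguments.
Unset Strict Implicit.
Unset Printing Implicit Defensive.

Local Open Scope classical_set_scope.

Definition p_point (W : set_system nat) : Prop :=
  [/\ UltraFilter W,
      forall n, W <> principal_filter n
    & forall A : nat -> set nat,
        (forall n, W (A n)) -> (forall n, A n.+1 `<=` A n) ->
        exists2 B, W B & forall n, finite_set (B `\` A n)].

Definition fubini_lim (W : set_system nat) (V : nat -> set_system nat) :
    set_system (nat * nat) :=
  [set A | W [set n | V n [set j | A (n, j)]]].

Definition olt (R : rel nat) (b a : nat) : Prop := R b a /\ b <> a.

Definition ozero (R : rel nat) (a : nat) : Prop := forall b, ~ olt R b a.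

Definition osucc (R : rel nat) (b a : nat) : Prop :=
  olt R b a /\ forall c, olt R c a -> R c b.

Definition olimit (R : rel nat) (a : nat) : Prop :=
  ~ ozero R a /\ forall b, ~ osucc R b a.

(* For a well-order R of nat, [fubini_level R a] is the class P_alpha, where
   alpha is the order type of the proper initial segment of R below a.
   Each V_n lives on omega, so the Fubini product, an ultrafilter on
   omega x omega, is carried back to omega along a bijection; every bijection is
   allowed, so that each level is closed under isomorphism. *)
Inductive fubini_level (R : rel nat) : nat -> set_system nat -> Prop :=
| fubini_level0 a U :
    ozero R a -> p_point U -> fubini_level R a U
| fubini_levelS a b W V (e : nat * nat -> nat) :
    osucc R b a -> p_point W -> (forall n, fubini_level R b (V n)) ->
    bijective e ->
    fubini_level R a [set Y | fubini_lim W V (e @^-1` Y)]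
| fubini_levelL a b U :
    olimit R a -> olt R b a -> fubini_level R b U -> fubini_level R a U.

(* The countable ordinals are exactly the order types of proper initial
   segments of well-orders of nat. *)
Definition fubini_iterate_of_p_points (U : set_system nat) : Prop :=
  exists2 R : rel nat, wochoice.well_order R & exists a, fubini_level R a U.

Definition cofinal_in {T : Type} (F X : set_system T) : Prop :=
  X `<=` F /\ forall A, F A -> exists2 B, X B & B `<=` A.

(* [tukey_le G F] is G <=_T F; only the values of f on F matter. *)
Definition tukey_le {S T : Type} (G : set_system S) (F : set_system T) : Prop :=
  exists2 f : set T -> set S,
    set_fun F G f & forall X, cofinal_in F X -> cofinal_in G (f @` X).

Definition tukey_equiv {S T : Type} (G : set_system S) (F : set_system T) :
    Prop :=
  tukey_le G F /\ tukey_le F G.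

Definition rk_le {S T : Type} (G : set_system S) (F : set_system T) : Prop :=
  exists h : T -> S, G = [set Y | F (h @^-1` Y)].

Definition fset_below (P : set {fset nat}) (A : set nat) : set P :=
  [set s : P | [set` \val s] `<=` A].
Arguments fset_below : clear implicits.

(* [Filter] does not exclude the improper filter, so the smallest filter always
   exists. *)
Definition fset_filter (U : set_system nat) (P : set {fset nat}) :
    set_system P :=
  smallest (@Filter P) [set fset_below P A | A in U].
Arguments fset_filter : clear implicits.

Lemma fset_filterE (U : set_system nat) (P : set {fset nat}) :
  Filter U -> fset_filter U P = filter_from U (fset_below P).
Proof.
move=> FU; apply/seteqP; split=> [X|X [A UA sAX] G [FG sG]].
  apply; split.
    apply: filter_from_filter; first by exists setT; exact: filterT.
    move=> A B UA UB; exists (A `&` B); first exact: filterI.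
    by move=> s sAB; split=> n /sAB[].
  by move=> _ [A UA <-]; exists A.
by apply: filterS sAX _; apply: sG; exists A.
Qed.

(* Main.v *)
(** The class of filters F on nat such that, for all A_0, A_1, ... in F, some
    a in F satisfies a \ m <= A_m for infinitely many m contains the p-points
    and is closed under countable sums, so every Fubini iterate of p-points is
    the image of such an F under a monotone cofinal map.  Given monotone cofinal
    maps g : F -> U and f : U -> V, a suitable a makes each fact
    "n is in f (g X)", for X <= a, depend on a finite subset of g X: apply the
    property to the A_m that collect, for each trace t of a set below m, a
    member Y of F with trace t and n not in f (g Y), if there is one.  Then P
    consists of the finite s for which some n = h s belongs to f (g X) for all
    X <= a in F with s <= g X.  As P is closed under supersets, the union of
    {s in P : s <= A} is A for A in U, whence U <=_T U(P). *)

Require Import Defs.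
From mathcomp Require Import all_boot finmap.
From mathcomp Require Import boolp classical_sets functions cardinality filter.

Set Implicit Arguments.
Unset Strict Implicit.
Unset Printing Implicit Defensive.

Local Open Scope classical_set_scope.

(** * Monotone cofinal maps between filters *)

Definition monotone_cofinal {S T : Type} (F : set_system T) (G : set_system S)
    (f : set T -> set S) : Prop :=
  [/\ forall A, F A -> G (f A),
      forall A B, F A -> F B -> A `<=` B -> f A `<=` f B
    & forall Y, G Y -> exists2 A, F A & f A `<=` Y].

Lemma monotone_cofinal_tukey {S T : Type} (F : set_system T) (G : set_system S)
    (f : set T -> set S) :
  monotone_cofinal F G f -> tukey_le G F.
Proof.
move=> [fG fmono fcof]; exists f; first by move=> A; exact: fG.
move=> X [XF Xcof]; split=> [_ [A XA <-]|Y GY]; first exact/fG/XF.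
have [A FA fAY] := fcof _ GY; have [B XB BA] := Xcof _ FA.
exists (f B); first by exists B.
by apply: subset_trans fAY; apply: fmono => //; exact: XF.
Qed.

(** The new map sends [A] to the union of the [f B] with [B] in [F] below [A]. If no value lay
    inside [Y], the [B] with [f B] not inside [Y] would be cofinal in [F], while their images would
    not be cofinal in [G]. *)
Lemma tukey_monotone_cofinal {S T : Type} (F : set_system T)
    (G : set_system S) : Filter F -> Filter G ->
  tukey_le G F -> exists f, monotone_cofinal F G f.
Proof.
move=> FF FG [f fG fcof].
exists (fun A => [set y | exists B, [/\ F B, B `<=` A & f B y]]); split.
- by move=> A FA; apply: filterS (fG _ FA) => y fAy; exists A; split.
- move=> A B _ _ AB y [D [FD DA fDy]]; exists D; split=> //.
  exact: subset_trans AB.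
- move=> Y GY; apply: contrapT => noA.
  pose X := [set B | F B /\ ~ (f B `<=` Y)].
  have [|_ /(_ _ GY)[_ [B [_ nfBY] <-] fBY]] := fcof X; last exact: nfBY.
  split=> [B []//|A FA]; apply: contrapT => noB; apply: noA; exists A => // y.
  move=> [B [FB BA fBy]]; suff: f B `<=` Y by apply.
  by apply: contrapT => nfBY; apply: noB; exists B.
Qed.

Lemma monotone_cofinal_comp {S T R : Type} (F : set_system T)
    (G : set_system S) (H : set_system R) (g : set T -> set S)
    (f : set S -> set R) :
  monotone_cofinal F G g -> monotone_cofinal G H f ->
  monotone_cofinal F H (f \o g).
Proof.
move=> [gG gmono gcof] [fH fmono fcof]; split=> [A FA|A B FA FB AB|Y HY] /=.
- exact/fH/gG.
- by apply: fmono; [exact: gG|exact: gG|exact: gmono].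
- have [B GB fBY] := fcof _ HY; have [A FA gAB] := gcof _ GB.
  by exists A => //; apply: subset_trans fBY; apply: fmono => //; exact: gG.
Qed.

(** * The diagonal property and p-points *)

(* For filters containing the cofinite sets, this says that F is a non-meager
   P-filter. *)
Definition diagonal_filter (F : set_system nat) : Prop :=
  Filter F /\
  forall A : nat -> set nat, (forall m, F (A m)) ->
    exists2 a, F a &
      forall k, exists2 m, k <= m & forall x, a x -> m <= x -> A m x.

(** Replacing each index [m] by some [nx m >= m] in [M] forces the good indices into [M]. *)
Lemma diagonal_filter_infinite (F : set_system nat) (A : nat -> set nat)
    (M : set nat) :
  diagonal_filter F -> (forall m, F (A m)) ->
  (forall k, exists2 m, k <= m & M m) ->
  exists2 a, F a & forall k, exists2 m, k <= m &
    M m /\ forall x, a x -> m <= x -> A m x.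
Proof.
move=> [FF FD] FA Minf.
have /choice[nx nxP] : forall k, exists m, k <= m /\ M m.
  by move=> k; have [m] := Minf k; exists m.
have [a Fa aA] := FD (A \o nx) (fun m => FA _).
exists a => // k; have [m km amA] := aA k; have [mnx Mnx] := nxP m.
exists (nx m); first exact: leq_trans mnx.
by split=> // x ax nxx; apply: amA => //; exact: leq_trans nxx.
Qed.

(** A pseudo-intersection [B] lies in [A m] from [nx m] on. Iterating [nx] cuts omega into
    intervals, and the ultrafilter [W] has a member avoiding all intervals of even index or all
    those of odd index. *)
Lemma p_point_diagonal (W : set_system nat) : p_point W -> diagonal_filter W.
Proof.
move=> [UW _ Wp]; split=> [|A WA]; first exact: ultra_proper.
pose A' m := [set x | forall i : 'I_m.+1, A i x].
have A'A m : A' m `<=` A m by move=> x /(_ ord_max).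
have WA' m : W (A' m) by apply: filter_forall => i; exact: WA.
have A'S m : A' m.+1 `<=` A' m.
  by move=> x Ax i; have := Ax (widen_ord (leqnSn _) i).
have [B WB BA] := Wp A' WA' A'S.
have /choice[nx nxP] : forall m, exists m',
    m < m' /\ forall x, B x -> m' <= x -> A m x.
  move=> m; have /finite_fsetP[s sE] := BA m.
  exists (maxn m.+1 (\max_(i <- s) i).+1).
  rewrite leq_max leqnn; split=> // x Bx; rewrite geq_max => /andP[_ sx].
  apply: A'A; apply: contrapT => nAx.
  have : [set` s] x by rewrite -sE.
  by move=> /= /(@leq_bigmax_seq _ _ xpredT id) /(_ isT); rewrite leqNgt sx.
(* B lies in A (mr r) only from mr r.+1 on; a member of W that omits the
   interval [mr r, mr r.+1) lies in it from mr r on. *)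
pose mr r := iter r nx 0.
have mrS r : mr r < mr r.+1 by have [] := nxP (mr r).
have mr_ge r : r <= mr r by elim: r => // r IH; exact: leq_ltn_trans (mrS r).
pose E (b : bool) := [set x | forall r, odd r = b -> mr r <= x -> mr r.+1 <= x].
have gap b : W (E b) -> exists2 a, W a &
    forall k, exists2 m, k <= m & forall x, a x -> m <= x -> A m x.
  move=> WE; exists (B `&` E b); first exact: filterI.
  move=> k; pose r := if odd k == b then k else k.+1.
  have rb : odd r = b by rewrite /r; case: eqP => //=; case: (odd k); case: (b).
  have kr : k <= r by rewrite /r; case: ifP.
  exists (mr r); first exact: leq_trans (mr_ge r).
  move=> x [Bx Ex] rx; have [_] := nxP (mr r); apply=> //; exact: Ex.
have mr_le i j : i <= j -> mr i <= mr j.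
  move=> /subnK <-; elim: (j - i) => // d IH.
  by rewrite addSn; exact: leq_trans IH (ltnW (mrS _)).
have [/gap//|WE] := in_ultra_setVsetC (E true) UW.
apply: (gap false); apply: filterS WE => x nE r rb rx.
apply: contrapT => /negP; rewrite -ltnNge => xr; apply: nE => r' r'b r'x.
have [r'r|rr'] := ltnP r' r; first exact: leq_trans (mr_le _ _ r'r) rx.
move: rr'; rewrite leq_eqVlt => /orP[/eqP rr'|/mr_le rr'].
  by rewrite rr' r'b in rb.
by have := leq_trans rr' r'x; rewrite leqNgt xr.
Qed.

(** * Countable sums and Fubini products *)

(** For bijective [e], this codes the product of the posets [G k] as a single filter. *)
Definition filter_sum (e : nat * nat -> nat) (G : nat -> set_system nat) :
    set_system nat :=
  [set A | forall k, G k [set x | A (e (k, x))]].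

(** At the index [c (n k)], coordinates [i < k] are handled by the diagonal property of [G i] along
    the nested infinite sets [Ms], and coordinates [i >= k] by intersecting with [A' i (n k)]
    outright. *)
Lemma filter_sum_diagonal (e : nat * nat -> nat) (G : nat -> set_system nat) :
  injective e -> (forall k, diagonal_filter (G k)) ->
  diagonal_filter (filter_sum e G).
Proof.
move=> einj GD; have FG k : Filter (G k) by have [] := GD k.
split=> [|A FA].
  split=> [k|A B FA FB k|A B AB FA k].
  - exact: filterT.
  - by apply: filterS (filterI (FA k) (FB k)).
  - by apply: filterS (FA k) => x; exact: AB.
(* For [k < m], the bound [c m <= e (k, x)] will force [m <= x]. *)
pose c m := m + (\max_(i < m) \max_(j < m) e (val i, val j)).+1.
have ec k x m : k < m -> x < m -> e (k, x) < c m.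
  move=> km xm; rewrite /c addnS ltnS; apply: leq_trans (leq_addl _ _).
  apply: leq_trans (leq_bigmax (Ordinal km)).
  exact: (leq_bigmax (Ordinal xm)).
pose A' k m := [set x | A (c m) (e (k, x))].
have FA' k m : G k (A' k m) by exact: FA.
pose inf (M : set nat) := forall k, exists2 m, k <= m & M m.
have /choice[al alP] : forall kM : nat * set nat, exists a,
    G kM.1 a /\ (inf kM.2 -> inf (kM.2 `&`
      [set m | forall x, a x -> m <= x -> A' kM.1 m x])).
  move=> -[k M]; have [Minf|nMinf] := pselect (inf M).
    have [a Ga aP] := diagonal_filter_infinite (GD k) (FA' k) Minf.
    by exists a.
  by exists setT; split=> //; exact: filterT.
pose fix Ms k := if k is k'.+1 then Ms k' `&`
    [set m | forall x, al (k', Ms k') x -> m <= x -> A' k' m x] else setT.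
have Msinf k : inf (Ms k).
  elim: k => [|k IH] /=; first by move=> k; exists k.
  by have [_] := alP (k, Ms k); apply.
have MsS i j : i <= j -> Ms j `<=` Ms i.
  by move=> /subnK <-; elim: (j - i) => // d IH x [/IH].
have /choice[n nP] : forall k, exists m, k <= m /\ Ms k.+1 m.
  by move=> k; have [m] := Msinf k.+1 k; exists m.
pose a k := al (k, Ms k) `&` [set x | forall j : 'I_k.+1, A' k (n j) x].
have Ga k : G k (a k).
  apply: filterI; first by have [] := alP (k, Ms k).
  by apply: filter_forall => j; exact: FA'.
exists [set y | exists2 p, y = e p & a p.1 p.2] => [k|k].
  by apply: filterS (Ga k) => x akx; exists (k, x).
have [kn _] := nP k.
exists (c (n k)); first by rewrite /c (leq_trans kn) ?leq_addr.
move=> _ [[i x] -> /= [alx ax]] cx.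
have [ki|ik] := ltnP i k; last by have := ax (Ordinal (ik : k < i.+1)).
have [_ /(MsS i.+1 k.+1 (ltnW ki))[_]] := nP k; apply=> //.
rewrite leqNgt; apply/negP => xn.
by have := ec _ _ _ (leq_trans ki kn) xn; rewrite ltnNge cx.
Qed.

Lemma fubini_lim_monotone_cofinal (e : nat * nat -> nat) (W : set_system nat)
    (V F : nat -> set_system nat) (g : nat -> set nat -> set nat) :
  injective e -> Filter W -> (forall n, Filter (V n)) ->
  (forall n, Filter (F n)) ->
  (forall n, monotone_cofinal (F n) (V n) (g n)) ->
  monotone_cofinal (filter_sum e (fun k => if k is n.+1 then F n else W))
    [set Y | fubini_lim W V (e @^-1` Y)]
    (fun A => [set y | exists p, [/\ y = e p, A (e (0, p.1)) &
       g p.1 [set x | A (e (p.1.+1, x))] p.2]]).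
Proof.
move=> einj FW FV FF gP; split.
- move=> A FA; rewrite /fubini_lim /=; apply: filterS (FA 0) => n An.
  have [gV _ _] := gP n; apply: filterS (gV _ (FA n.+1)) => j gj.
  by exists (n, j).
- move=> A B FA FB AB _ [[n j] /= [-> An gj]]; exists (n, j); split=> //.
    exact: AB.
  have [_ gmono _] := gP n; apply: gmono gj; first exact: (FA n.+1).
    exact: (FB n.+1).
  by move=> x; exact: AB.
- move=> Y; rewrite /fubini_lim /= => WY.
  have /choice[D DP] : forall n, exists D, F n D /\
      (V n [set j | Y (e (n, j))] -> g n D `<=` [set j | Y (e (n, j))]).
    move=> n; have [Vn|nVn] := pselect (V n [set j | Y (e (n, j))]).
      by have [_ _ /(_ _ Vn)[A FA gA]] := gP n; exists A.
    by exists setT; split=> //; exact: filterT.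
  pose a k := if k is n.+1 then D n else [set n | V n [set j | Y (e (n, j))]].
  pose A := [set y | exists2 p, y = e p & a p.1 p.2].
  have AE k x : A (e (k, x)) = a k x.
    by apply/propext; split=> [[p /einj <-//]|akx]; exists (k, x).
  exists A.
    move=> k; under eq_set do rewrite AE.
    by case: k => [//|n]; have [] := DP n.
  move=> _ [[n j] /= [->]]; rewrite AE /= => Vn.
  by under eq_set do rewrite AE; move=> /= gj; have [_ /(_ Vn)] := DP n; apply.
Qed.

Lemma fubini_level_filter (R : rel nat) (a : nat) (W : set_system nat) :
  fubini_level R a W -> Filter W.
Proof.
elim=> [{}a U _ [UU _ _]|{}a b {}W V e _ [UW _ _] _ FV _|//].
  exact: ultra_proper.
have FW : Filter W by exact: ultra_proper.
split; rewrite /fubini_lim /=.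
- by apply: filterS filterT => n _; exact: filterT.
- move=> A B WA WB; apply: filterS (@filterI _ W _ _ _ WA WB) => n [VA VB].
  exact: filterI.
- by move=> A B AB; apply: filterS => n; apply: filterS => j; exact: AB.
Qed.

(** By induction on the level: a p-point is its own [F]; at a successor, take the sum of the p-point
    [W] and the filters found for the [V n]. *)
Lemma fubini_level_diagonal (R : rel nat) (a : nat) (W : set_system nat) :
  fubini_level R a W ->
  exists2 F, diagonal_filter F & exists g, monotone_cofinal F W g.
Proof.
elim=> [{}a U _ Up|{}a b {}W V e _ Wp lV FV [e' eK _]|//].
  exists U; first exact: p_point_diagonal.
  by exists id; split=> // Y UY; exists Y.
have {FV}/choice[Fg FgP] : forall n,
    exists Fg : set_system nat * (set nat -> set nat),
      diagonal_filter Fg.1 /\ monotone_cofinal Fg.1 (V n) Fg.2.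
  by move=> n; have [F FD [g gP]] := FV n; exists (F, g).
have einj := can_inj eK; have WD := p_point_diagonal Wp.
eexists; last first.
  eexists; apply: (@fubini_lim_monotone_cofinal e W V (fun n => (Fg n).1)
    (fun n => (Fg n).2)) => // [|n|n|n].
  - by case: WD.
  - exact: fubini_level_filter (lV n).
  - by have [[]] := FgP n.
  - by have [] := FgP n.
by apply: filter_sum_diagonal => // -[|n] //; have [] := FgP n.
Qed.

(** * Finite supports *)

(* There are finitely many traces t of members X of F below m, and X is
   contained in the largest subset of a with trace t; so it is enough that s
   witnesses each failure of g A <= g (t u (a \ m)). *)
Lemma finite_support (F : set_system nat) (g f : set nat -> set nat) :
  diagonal_filter F ->
  (forall X Y, F X -> F Y -> X `<=` Y -> g X `<=` g Y) ->
  (forall X Y, F X -> F Y -> g X `<=` g Y -> f (g X) `<=` f (g Y)) ->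
  exists2 a, F a & forall A n, F A -> f (g A) n ->
    exists2 s : {fset nat}, [set` s] `<=` g A &
      forall X, F X -> X `<=` a -> [set` s] `<=` g X -> f (g X) n.
Proof.
move=> [FF FD] gmono fmono.
pose trace m (t : {set 'I_m}) (X : set nat) := forall i : 'I_m, X i <-> i \in t.
have /choice[Y YP] : forall q : {m : nat & {set 'I_m} * 'I_m}%type, exists Y,
    F Y /\ ((exists X, [/\ F X, trace _ (projT2 q).1 X &
        ~ f (g X) (projT2 q).2]) ->
      trace _ (projT2 q).1 Y /\ ~ f (g Y) (projT2 q).2).
  move=> -[m [t i]] /=.
  have [[X [FX Xt nX]]|noX] :=
    pselect (exists X, [/\ F X, trace m t X & ~ f (g X) i]); first by exists X.
  by exists setT; split=> //; exact: filterT.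
have [|a Fa aP] := FD (fun m => [set x | forall (t : {set 'I_m}) (i : 'I_m),
    Y (existT _ m (t, i)) x]).
  move=> m; apply: filter_forall => t; apply: filter_forall => i.
  by have [] := YP (existT _ m (t, i)).
(* Asking for [m > n] makes [n] one of the points for which [Y] was chosen. *)
exists a => // A n FA An; have [m nm amY] := aP n.+1.
pose top (t : {set 'I_m}) : set nat :=
  [set x : nat | (exists2 i : 'I_m, i \in t & x = i) \/ a x /\ m <= x].
have /choice[j jP] : forall t, exists j,
    ~ (g A `<=` g (top t)) -> g A j /\ ~ g (top t) j.
  move=> t; have [gAt|/existsNP[x /not_implyP xP]] :=
    pselect (g A `<=` g (top t)); first by exists 0.
  by exists x.
have [s sP] : exists s : {fset nat}, forall x, x \in s <->
    exists2 t, x = j t & ~ (g A `<=` g (top t)).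
  exists [fset j t | t in {set 'I_m} & `[< ~ (g A `<=` g (top t))%classic >]]%fset.
  move=> x; split=> [/imfsetP[t /= /asboolP tP ->]|[t -> tP]]; first by exists t.
  by apply/imfsetP; exists t => //=; exact/asboolP.
exists s => [x /sP[t -> /jP[]]//|X FX Xa sX].
pose t := [set i : 'I_m | `[< X i >]]%SET.
have Xt : trace m t X by move=> i; rewrite inE; split=> /asboolP.
have Xtop : X `<=` top t.
  move=> x Xx; have [mx|xm] := leqP m x; first by right; split=> //; exact: Xa.
  by left; exists (Ordinal xm) => //; exact/Xt.
have Ftop : F (top t) by apply: filterS FX.
have gAtop : g A `<=` g (top t).
  apply: contrapT => nA; have [_] := jP _ nA; apply.
  by apply: (gmono X) => //; apply: sX; apply/sP; exists t.
(* Here [Y q] has trace [t] and contains [a] from [m] on, so it contains [top t]. Hence [g A] is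
   inside [g (Y q)], which puts [n] in [f (g (Y q))], against the choice of [Y q]. *)
apply: contrapT => nX; pose q := existT _ m (t, Ordinal nm) : {m : nat & _}.
have [FY YX] := YP q; have [|/= Yt nY] := YX; first by exists X.
apply: nY; apply: (fmono A) An => //; apply: (subset_trans gAtop).
apply: gmono => // x [[i it ->]|[ax mx]]; first exact/Yt.
exact: amY.
Qed.

(** * The filter generated on [P] *)

Lemma fset_filter_tukey_le (U : set_system nat) (P : set {fset nat}) :
  Filter U -> tukey_le (fset_filter U P) U.
Proof.
move=> FU; apply: (@monotone_cofinal_tukey _ _ _ _ (fset_below P)).
rewrite fset_filterE //; split=> [A UA|A B _ _ AB s sA|//]; first by exists A.
exact: subset_trans AB.
Qed.

(** The union map [un] recovers [A] in [U] from [fset_below P A]: any point of [A] can be added to a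
    member of [P] inside [A]. *)
Lemma tukey_le_fset_filter (U : set_system nat) (P : set {fset nat}) :
  Filter U ->
  (forall s x, P s -> P (x |` s)%fset) ->
  (forall A, U A -> exists2 s, P s & [set` s] `<=` A) ->
  tukey_le U (fset_filter U P).
Proof.
move=> FU Pup PU; pose un (X : set P) := \bigcup_(s in X) [set` \val s].
have unU A : U A -> A `<=` un (fset_below P A).
  move=> UA x Ax; have [s Ps sA] := PU _ UA.
  have Pxs := Pup s x Ps; exists (exist _ (x |` s)%fset (mem_set Pxs)).
    by move=> y /=; rewrite in_fset1U => /orP[/eqP ->//|/sA].
  by rewrite /= fset1U1.
apply: (@monotone_cofinal_tukey _ _ _ _ un); rewrite fset_filterE //; split.
- move=> X [A UA AX]; apply: (filterS _ UA) => x /(unU _ UA)[s sA xs].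
  by exists s => //; exact: AX.
- by move=> X Y _ _ XY x [s Xs xs]; exists s => //; exact: XY.
- move=> A UA; exists (fset_below P A); first by exists A.
  by move=> x [s sA /sA].
Qed.

(** * Construction of [P] and of the Rudin-Keisler map *)

Theorem theorem6p4 (U : set_system nat) (hU : UltraFilter U)
    (hUF : exists2 W : set_system nat,
             fubini_iterate_of_p_points W & tukey_le U W)
    (V : set_system nat) (hV : UltraFilter V) (hVU : tukey_le V U) :
  exists P : set {fset nat},
    tukey_equiv (fset_filter U P) U /\ rk_le V (fset_filter U P).
Proof.
have PFU : ProperFilter U by exact: ultra_proper.
have PFV : ProperFilter V by exact: ultra_proper.
have [f fP] := tukey_monotone_cofinal _ _ hVU.
have [W [R _ [b lW]] UW] := hUF.
have FW := fubini_level_filter lW.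
have [k kP] := tukey_monotone_cofinal _ _ UW.
have [F FD [l lP]] := fubini_level_diagonal lW.
have := monotone_cofinal_comp lP kP; set g := k \o l => gP.
have [gU gmono gcof] := gP; have [fV fmono fcof] := fP.
have FF : Filter F by case: FD.
have [|a Fa aP] := @finite_support F g f FD gmono.
  by move=> X Y FX FY; apply: fmono; exact: gU.
pose P : set {fset nat} := [set s | exists n, forall X,
  F X -> X `<=` a -> [set` s] `<=` g X -> f (g X) n].
have below A : U A -> exists2 X, F X & X `<=` a /\ g X `<=` A.
  move=> UA; have [X FX gXA] := gcof _ UA.
  have FXa : F (X `&` a) by exact: filterI.
  exists (X `&` a) => //; split; first by move=> x [].
  by apply: subset_trans gXA; apply: gmono => // x [].
have PU A : U A -> exists2 s, P s & [set` s] `<=` A.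
  (* As [V] is proper, [f (g X)] has an element, and its finite support belongs to [P]. *)
  move=> /below[X FX [Xa gXA]]; have [n Xn] := filter_ex (fV _ (gU _ FX)).
  have [s sX sP] := aP _ _ FX Xn.
  by exists s; [exists n|exact: subset_trans gXA].
have Pup s x : P s -> P (x |` s)%fset.
  move=> [n nP]; exists n => X FX Xa sX; apply: nP => // y ys.
  by apply: sX => /=; rewrite in_fset1U ys orbT.
exists P; split; first split.
- exact: fset_filter_tukey_le.
- exact: tukey_le_fset_filter.
have /choice[h hP] : forall s : P, exists n, forall X,
    F X -> X `<=` a -> [set` \val s] `<=` g X -> f (g X) n.
  by move=> s; have := set_valP s.
have hV' Y : V Y -> fset_filter U P (h @^-1` Y).
  move=> VY; have [A UA fAY] := fcof _ VY; have [X FX [Xa gXA]] := below _ UA.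
  rewrite fset_filterE //; exists (g X); first exact: gU.
  (* For [s] below [g X], the value [h s] lies in [f (g X)], hence in [f A]. *)
  move=> s sX; apply: fAY; apply: (fmono (g X)) => //; first exact: gU.
  exact: hP.
exists h; apply/seteqP; split=> [//|Y /= UPY].
(* If [Y] were not in [V], the preimages of [Y] and of its complement would both be in the filter on
   [P]; but a member of [P] inside [A] and [B] lies in both. *)
have [//|/hV'] := in_ultra_setVsetC Y hV; move: UPY.
rewrite fset_filterE // => -[A UA AY] [B UB BY].
have [s Ps sAB] := PU _ (filterI UA UB).
pose s' : P := exist _ s (mem_set Ps).
by case: (BY s') => [x /sAB[]//|]; apply: AY => x /sAB[].
Qed.
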